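(* Let $R$ be a principal ideal domain, let $I$ be a (possibly infinite) totally ordered set, regarded as a poset category, and let $f: I\to R\text{-Mod}$ be a persistence module such that $f_i$ is a finitely generated free $R$-module for every $i\in I$. Then $f$ admits an interval decomposition if and only if, for all $a\le b$ in $I$, the structure map $f(a\le b): f_a\to f_b$ has free cokernel.
   Context: A persistence module indexed by $I$ with coefficients in $R$ is a functor $f: I\to R\text{-Mod}$; $f_a$ denotes its value at $a$, and $f(a\le b): f_a\to f_b$ its structure maps. Morphisms of persistence modules are natural transformations. An interval of $I$ is a subset $J\subseteq I$ such that $a,b\in J$, $c\in I$ and $a\le c\le b$ imply $c\in J$. The interval module $h^J$ of an interval $J$ is the persistence module with $h^J_a=R$ if $a\in J$ and $h^J_a=0$ otherwise, and with $h^J(a\le b)=\mathrm{id}_R$ if $a,b\in J$ and $h^J(a\le b)=0$ otherwise. An interval submodule of $f$ is a persistence submodule of $f$ isomorphic to an interval module. An interval decomposition of $f$ is a direct-sum decomposition of $f$ (as a persistence module) in which each summand is an interval submodule. *)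

(* Defs.v *)
From HB Require Import structures.
From mathcomp Require Import all_boot all_order all_algebra.
From mathcomp Require Import generic_quotient ring_quotient.
From mathcomp Require Import boolp classical_sets cardinality fsbigop.

Set Implicit Arguments.
Unset Strict Implicit.
Unset Printing Implicit Defensive.

Import Order.TTheory GRing.Theory.
Local Open Scope order_scope.
Local Open Scope classical_set_scope.
Local Open Scope ring_scope.

(* Ideals of R are the R-submodules of the regular module R^o; a predicate is
   boolean, which by boolp is no restriction. *)
Definition principal_ideal_domain (R : idomainType) : Prop :=
  forall A : {pred R^o}, submod_closed A ->
    exists a : R, forall x : R, x \in A <-> exists r : R, x = r * a.

Section Modules.
Variable R : nzRingType.

Definition is_basis (M : lmodType R) (K : choiceType) (e : K -> M) : Prop :=
  forall x : M, exists! c : K -> R,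
    finite_set [set k | c k != 0] /\ x = \sum_(k \in [set: K]) c k *: e k.

Definition free_module (M : lmodType R) : Prop :=
  exists (K : choiceType) (e : K -> M), is_basis e.

Definition finitely_generated (M : lmodType R) : Prop :=
  exists s : seq M, forall x : M, exists c : 'I_(size s) -> R,
    x = \sum_(i < size s) c i *: s`_i.

End Modules.

Section Submodule.
Variables (R : nzRingType) (V : lmodType R) (S : submodClosed V).

Definition submodule := {x : V | x \in S}.

HB.instance Definition _ := SubChoice.on submodule.
HB.instance Definition _ := [SubChoice_isSubLmodule of submodule by <:].

End Submodule.

Section Quotient.
Variables (R : nzRingType) (V : lmodType R) (S : submodClosed V).
Local Open Scope quotient_scope.

(* submodClosed does not inherit from zmodClosed, which Quotient.quot needs. *)
Definition submod_pred : {pred V} := fun x => x \in S.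

Lemma submod_predP : submod_closed submod_pred.
Proof. exact: GRing.submodClosedP. Qed.

HB.instance Definition _ := GRing.isSubmodClosed.Build R V submod_pred
  (GRing.submod_closed_semi submod_predP).

Definition quotient_module := Quotient.quot submod_pred.

HB.instance Definition _ := GRing.Zmodule.on quotient_module.
HB.instance Definition _ := ZmodQuotient.on quotient_module.

Definition quotient_scale (r : R) (x : quotient_module) : quotient_module :=
  \pi_(quotient_module) (r *: repr x).

Lemma pi_scale r (v : V) :
  quotient_scale r (\pi_(quotient_module) v) = \pi_(quotient_module) (r *: v).
Proof.
apply/eqP; rewrite /quotient_scale -Quotient.idealrBE -scalerBr rpredZ //.
by rewrite Quotient.idealrBE reprK.
Qed.

Lemma quotient_scaleA r s x :
  quotient_scale r (quotient_scale s x) = quotient_scale (r * s) x.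
Proof. by rewrite [quotient_scale s x]/quotient_scale pi_scale scalerA. Qed.

Lemma quotient_scale1 : left_id 1 quotient_scale.
Proof. by move=> x; rewrite /quotient_scale scale1r reprK. Qed.

Lemma quotient_scaleDr : right_distributive quotient_scale +%R.
Proof.
move=> r x y; rewrite -[x]reprK -[y]reprK !pi_scale.
have piD (u v : V) : \pi_(quotient_module) u + \pi_(quotient_module) v =
    \pi_(quotient_module) (u + v) by rewrite !piE.
by rewrite !piD pi_scale scalerDr.
Qed.

Lemma quotient_scaleDl x : {morph quotient_scale^~ x : r s / r + s}.
Proof. by move=> r s; rewrite /quotient_scale scalerDl !piE. Qed.

HB.instance Definition _ := GRing.Zmodule_isLmodule.Build R quotient_module
  quotient_scaleA quotient_scale1 quotient_scaleDr quotient_scaleDl.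

End Quotient.

Section Cokernel.
Variables (R : nzRingType) (U V : lmodType R) (g : {linear U -> V}).

Definition image_pred : {pred V} := fun y => `[< exists x, g x = y >].

Lemma image_pred_closed : submod_closed image_pred.
Proof.
split=> [|r u v /asboolP[x <-] /asboolP[y <-]]; apply/asboolP.
  by exists 0; rewrite linear0.
by exists (r *: x + y); rewrite linearP.
Qed.

HB.instance Definition _ := GRing.isSubmodClosed.Build R V image_pred
  (GRing.submod_closed_semi image_pred_closed).

Definition cokernel : lmodType R := quotient_module image_pred.

End Cokernel.

Section PersistenceModules.
Variables (R : nzRingType) (d : Order.disp_t) (I : porderType d).

Record persistence_module := PersistenceModule {
  pm_obj :> I -> lmodType R;
  pm_map : forall a b : I, (a <= b)%O -> {linear pm_obj a -> pm_obj b};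
  pm_map_id : forall (a : I) (aa : (a <= a)%O) (x : pm_obj a),
    pm_map aa x = x;
  pm_map_comp : forall (a b c : I) (ab : (a <= b)%O) (bc : (b <= c)%O)
    (ac : (a <= c)%O) (x : pm_obj a), pm_map bc (pm_map ab x) = pm_map ac x }.

Record pm_morphism (f g : persistence_module) := PMMorphism {
  pm_comp :> forall a : I, {linear f a -> g a};
  pm_natural : forall (a b : I) (ab : (a <= b)%O) (x : f a),
    pm_comp b (pm_map f ab x) = pm_map g ab (pm_comp a x) }.

Definition pm_isomorphic (f g : persistence_module) : Prop :=
  exists (phi : pm_morphism f g) (psi : pm_morphism g f),
    forall a : I, cancel (phi a) (psi a) /\ cancel (psi a) (phi a).

Record interval := Interval {
  interval_set :> set I;
  interval_convex : forall a b c : I, interval_set a -> interval_set b ->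
    (a <= c <= b)%O -> interval_set c }.

Section IntervalModule.
Variable J : interval.

(* 'rV[R]_0 serves as the zero module. *)
Definition interval_obj (inJ : bool) : lmodType R :=
  if inJ then (R^o : lmodType R) else ('rV[R]_0 : lmodType R).

Definition interval_map (inJ inJ' : bool) :
    {linear interval_obj inJ -> interval_obj inJ'} :=
  match inJ, inJ' with
  | true, true => (idfun : {linear R^o -> R^o})
  | i, i' => (\0 : {linear interval_obj i -> interval_obj i'})
  end.

Lemma interval_map_id (i : bool) (x : interval_obj i) : interval_map i i x = x.
Proof. by case: i x => //= x; rewrite thinmx0; apply/esym/thinmx0. Qed.

Lemma interval_map_comp (i j k : bool) (x : interval_obj i) :
  (i -> k -> j) -> interval_map j k (interval_map i j x) = interval_map i k x.
Proof.
by case: i x => x; case: j; case: k => //= ijk; try exact: linear0; have := ijk isT isT.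
Qed.

Fact interval_module_id (a : I) (aa : (a <= a)%O)
    (x : interval_obj (a \in (J : set I))) : interval_map _ _ x = x.
Proof. exact: interval_map_id. Qed.

Fact interval_module_comp (a b c : I) (ab : (a <= b)%O) (bc : (b <= c)%O)
    (ac : (a <= c)%O) (x : interval_obj (a \in (J : set I))) :
  interval_map (b \in (J : set I)) (c \in (J : set I)) (interval_map _ _ x) =
  interval_map _ _ x.
Proof.
apply: interval_map_comp; rewrite !inE => Ja Jc.
by apply: (interval_convex Ja Jc); rewrite ab.
Qed.

Definition interval_module : persistence_module :=
  @PersistenceModule (fun a => interval_obj (a \in (J : set I)))
    (fun a b _ => interval_map (a \in (J : set I)) (b \in (J : set I)))
    interval_module_id interval_module_comp.

End IntervalModule.

Section PersistenceSubmodule.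
Variable f : persistence_module.

Record persistence_submodule := PersistenceSubmodule {
  psub_at :> forall a : I, submodClosed (f a);
  psub_stable : forall (a b : I) (ab : (a <= b)%O) (x : f a),
    x \in psub_at a -> pm_map f ab x \in psub_at b }.

Variable N : persistence_submodule.

Section Map.
Variables (a b : I) (ab : (a <= b)%O).

Definition psub_map (x : submodule (N a)) : submodule (N b) :=
  Sub (pm_map f ab (val x)) (psub_stable ab (valP x)).

Lemma psub_map_linear : linear psub_map.
Proof. by move=> r x y; apply: val_inj; rewrite /= !linearP. Qed.

HB.instance Definition _ := GRing.isLinear.Build R
  (submodule (N a)) (submodule (N b)) _ psub_map psub_map_linear.

End Map.

Fact psub_map_id (a : I) (aa : (a <= a)%O) (x : submodule (N a)) :
  psub_map aa x = x.
Proof. by apply: val_inj; rewrite /= pm_map_id. Qed.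

Fact psub_map_comp (a b c : I) (ab : (a <= b)%O) (bc : (b <= c)%O)
    (ac : (a <= c)%O) (x : submodule (N a)) :
  psub_map bc (psub_map ab x) = psub_map ac x.
Proof. by apply: val_inj; rewrite /= (pm_map_comp ab bc ac). Qed.

Definition psub_module : persistence_module :=
  @PersistenceModule (fun a => submodule (N a) : lmodType R)
    (fun a b ab => psub_map ab : {linear _ -> _})
    psub_map_id psub_map_comp.

Definition is_interval_submodule : Prop :=
  exists J : interval, pm_isomorphic psub_module (interval_module J).

End PersistenceSubmodule.

(* Internal direct sum of a possibly infinite family of submodules. *)
Definition is_direct_sum_decomposition (f : persistence_module)
    (K : choiceType) (N : K -> persistence_submodule f) : Prop :=
  forall (a : I) (x : f a), exists! v : K -> f a,
    [/\ finite_set [set k | v k != 0], forall k, v k \in N k a &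
        x = \sum_(k \in [set: K]) v k].

Definition has_interval_decomposition (f : persistence_module) : Prop :=
  exists (K : choiceType) (N : K -> persistence_submodule f),
    is_direct_sum_decomposition N /\ forall k, is_interval_submodule (N k).

End PersistenceModules.

(* Main.v *)
(* A bar is a family [e x] in [f x] that is transported by the transition maps
   from every [x] with [e x != 0]; its support is then an interval, and an
   interval decomposition is the same as a set of bars whose nonzero values form
   a basis of each [f x].

   If all cokernels are free, images and kernels of the transition maps are
   saturated, and saturated submodules of a finitely generated module satisfy the
   descending chain condition by rank.  Zorn's lemma gives a maximal independent
   set of bars with pure span [N].  If [N a] were not all of [f a], take [x0 <= a]
   whose image in [f a] is smallest among those not contained in [N a], and [y0]
   such that the kernel of [f a -> f y0] is smallest among the [y >= a] at which
   that image acquires new kernel modulo [N].  An element of the image killed at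
   [y0] and primitive modulo [N a] (this uses that R is principal) extends upwards
   by transport.  It extends downwards by a second use of Zorn's lemma, inside the
   submodules of elements that lift arbitrarily far down; the chain condition
   makes the maps between these surjective and replaces the linear compactness
   available over a field.  The new bar keeps the span pure, a contradiction. *)

From HB Require Import structures.
Require Import Defs.
From mathcomp Require Import all_boot all_order all_algebra.
From mathcomp Require Import generic_quotient ring_quotient.
From mathcomp Require Import boolp classical_sets cardinality fsbigop.

Set Implicit Arguments.
Unset Strict Implicit.
Unset Printing Implicit Defensive.

Import Order.TTheory GRing.Theory.
Local Open Scope order_scope.
Local Open Scope classical_set_scope.
Local Open Scope ring_scope.

(** * Submodules and saturation for sets of vectors *)

Definition submod_set (R : nzRingType) (V : lmodType R) (S : set V) : Prop :=
  S 0 /\ forall (r : R) u v, S u -> S v -> S (r *: u + v).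

Definition saturated (R : nzRingType) (V : lmodType R) (S : set V) : Prop :=
  forall (r : R) v, r != 0 -> S (r *: v) -> S v.

Section SubmoduleSets.
Variables (R : nzRingType) (V : lmodType R) (S : set V).
Hypothesis S_submod : submod_set S.

Lemma submodD u v : S u -> S v -> S (u + v).
Proof. by move=> Su Sv; rewrite -[u]scale1r; apply: S_submod.2. Qed.

Lemma submodZ r u : S u -> S (r *: u).
Proof. by move=> Su; rewrite -[_ *: _]addr0; apply: S_submod.2 => //; apply: S_submod.1. Qed.

Lemma submodN u : S u -> S (- u).
Proof. by move=> Su; rewrite -scaleN1r; apply: submodZ. Qed.

Lemma submodB u v : S u -> S v -> S (u - v).
Proof. by move=> Su Sv; apply: submodD => //; apply: submodN. Qed.

Lemma submodBC u v : S (u - v) -> S (v - u).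
Proof. by move=> /submodN; rewrite opprB. Qed.

Lemma submod_congr u v : S (u - v) -> S v -> S u.
Proof. by move=> Suv Sv; rewrite -(subrK v u); apply: submodD. Qed.

Lemma submod_trans u v w : S (u - v) -> S (v - w) -> S (u - w).
Proof. by move=> Suv Svw; rewrite -(subrKA v u); apply: submodD. Qed.

End SubmoduleSets.

Arguments submodZ {R V S} S_submod r {u}.

(** * Saturated submodules and principal ideals *)

(** Gaussian elimination by cross-multiplication, which avoids the fraction field: [B] clears column
    0 against a pivot row [i]. If column 0 vanishes, it is dropped together with row 0. *)
Lemma dependent_rows (R : idomainType) (n : nat) (A : 'I_n.+1 -> 'I_n -> R) :
  exists c : 'I_n.+1 -> R, (exists i, c i != 0) /\
    forall j, \sum_i c i * A i j = 0.
Proof.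
elim: n A => [|n IHn] A.
  by exists (fun=> 1); split; [exists ord0; rewrite oner_eq0 | case].
have [[i Ai]|A0] := pselect (exists i, A i ord0 != 0).
  pose B k j := A i ord0 * A (lift i k) (lift ord0 j) -
                A (lift i k) ord0 * A i (lift ord0 j).
  have [c [[k ck] cB]] := IHn B.
  (* The pivot row receives the coefficient that makes column 0 cancel. *)
  pose c' j := if unlift i j is Some k then c k * A i ord0
               else - \sum_k c k * A (lift i k) ord0.
  exists c'; split.
    by exists (lift i k); rewrite /c' liftK mulf_neq0.
  move=> j; rewrite (bigD1_ord i) //= {1}/c' unlift_none.
  under eq_bigr do rewrite /c' liftK.
  rewrite mulNr mulr_suml -sumrN -big_split /=.
  case: (unliftP ord0 j) => [j'|] ->; last first.
    by apply: big1 => l _; rewrite mulrAC addNr.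
  rewrite -[RHS](cB j'); apply: eq_bigr => l _.
  by rewrite /B mulrBr !mulrA addrC.
have [c [[k ck] cB]] := IHn (fun k j => A (lift ord0 k) (lift ord0 j)).
exists (fun j => if unlift ord0 j is Some k then c k else 0); split.
  by exists (lift ord0 k); rewrite liftK.
move=> j; rewrite (bigD1_ord ord0) //= unlift_none mul0r add0r.
under eq_bigr do rewrite liftK.
case: (unliftP ord0 j) => [j'|] -> //.
apply: big1 => l _; case: (eqVneq (A (lift ord0 l) ord0) 0) => [->|Al].
  by rewrite mulr0.
by case: A0; exists (lift ord0 l).
Qed.

(** * Rank and the descending chain condition *)

Section SaturatedChains.
Variables (R : idomainType) (M : lmodType R).

Definition independent (n : nat) (u : 'I_n -> M) : Prop :=
  forall c : 'I_n -> R, \sum_i c i *: u i = 0 -> forall i, c i = 0.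

Lemma fg_rank_bound (M_fg : finitely_generated M) :
  exists n, forall u : 'I_n.+1 -> M, ~ independent u.
Proof.
have [s sP] := M_fg; exists (size s) => u indep_u.
have [A AP] := choice (fun i => sP (u i)).
have [c [[k ck] cA]] := dependent_rows A.
suff /indep_u c0 : \sum_i c i *: u i = 0 by rewrite c0 eqxx in ck.
under eq_bigr do rewrite AP scaler_sumr.
rewrite exchange_big /= big1 // => j _.
by under eq_bigr do rewrite scalerA; rewrite -scaler_suml cA scale0r.
Qed.

Lemma independent_extend (S : set M) n (u : 'I_n -> M) t :
    submod_set S -> saturated S -> independent u -> (forall i, S (u i)) ->
    ~ S t ->
  independent (fun i : 'I_n.+1 => oapp u t (unlift ord0 i)).
Proof.
move=> Ssub Ssat u_ind Su nSt c.
rewrite (bigD1_ord ord0) //= unlift_none /=.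
under eq_bigr do rewrite liftK /=.
move=> c_sum; have c0 : c ord0 = 0.
  apply/eqP/negPn/negP => c0; apply: nSt; apply: (Ssat _ _ c0).
  move/eqP: c_sum; rewrite addr_eq0 => /eqP ->.
  apply: (submodN Ssub); apply: big_ind => [|x y|i _]; first exact: Ssub.1.
    exact: submodD.
  exact: submodZ.
move: c_sum; rewrite c0 scale0r add0r => /u_ind ck i.
by case: (unliftP ord0 i) => [j|] ->; [exact: ck | ].
Qed.

(** An index whose submodule has least rank works: if [S j] missed some [t] of [S i], then adding
    [t] to an independent family of that rank in [S j] would give, by [independent_extend], a family
    too large for [S i]. *)
Lemma saturated_dcc (M_fg : finitely_generated M) (T : Type) (P : set T)
    (S : T -> set M) :
    (forall i, submod_set (S i)) -> (forall i, saturated (S i)) -> P !=set0 ->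
  exists i, P i /\ forall j, P j -> S j `<=` S i -> S i `<=` S j.
Proof.
move=> Ssub Ssat [i0 Pi0]; have [n nP] := fg_rank_bound M_fg.
(* [small k i] bounds the rank of [S i] by [k]. *)
pose small k i := forall u : 'I_k.+1 -> M, (forall l, S i (u l)) -> ~ independent u.
pose Q k := `[< exists i, P i /\ small k i >].
have exQ : exists k, Q k by exists n; apply/asboolP; exists i0; split.
case: (ex_minnP exQ) => m /asboolP[i [Pi mi]] m_min.
exists i; split=> // j Pj Sji t Sit; apply: contrapT => nSjt.
suff [u [Su u_ind]] : exists u : 'I_m -> M, (forall l, S j (u l)) /\ independent u.
  apply: (mi (fun l => oapp u t (unlift ord0 l))).
    by move=> l; case: (unlift ord0 l) => //= l'; apply: Sji.
  exact: independent_extend nSjt.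
case: m {mi} m_min => [|m] m_min.
  by exists (fun=> 0); split=> [[]//|c _ []//].
apply: contrapT => no_u; have /m_min : Q m; last by rewrite ltnn.
apply/asboolP; exists j; split=> // u Su u_ind.
by apply: no_u; exists u.
Qed.

End SaturatedChains.

(** * Bezout relations and primitive elements over a principal ideal domain *)

Section PrincipalIdeals.
Variable R : idomainType.
Hypothesis R_pid : principal_ideal_domain R.

Lemma pid_ideal (A : set R) : A 0 -> (forall r x y, A x -> A y -> A (r * x + y)) ->
  exists2 a, A a & forall x, A x -> exists r, x = r * a.
Proof.
move=> A0 Alin; have [|a aP] := R_pid (A := fun x : R^o => `[< A x >]).
  split=> [|r x y /asboolP Ax /asboolP Ay]; apply/asboolP => //.
  exact: (Alin r x y).
exists a.
  have /asboolP // : a \in ((fun x : R^o => `[< A x >]) : {pred R^o}).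
  by apply/aP; exists 1; rewrite mul1r.
by move=> x Ax; apply/aP; apply/asboolP.
Qed.

Lemma pid_bezout (a b : R) : a != 0 ->
  exists g a' b' u v, [/\ a = a' * g, b = b' * g, g != 0 & u * a' + v * b' = 1].
Proof.
move=> a0; pose A x := exists u v, x = u * a + v * b.
have [||g [u [v gE]] gP] := @pid_ideal A.
- by exists 0, 0; rewrite !mul0r addr0.
- move=> r _ _ [u [v ->]] [u' [v' ->]]; exists (r * u + u'), (r * v + v').
  by rewrite mulrDr !mulrA !mulrDl !addrA; congr (_ + _); rewrite addrAC.
have [a' aE] : exists r, a = r * g by apply: gP; exists 1, 0; rewrite mul1r mul0r addr0.
have [b' bE] : exists r, b = r * g by apply: gP; exists 0, 1; rewrite mul1r mul0r add0r.
have g0 : g != 0 by apply: contraNneq a0 => g0; rewrite aE g0 mulr0.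
exists g, a', b', u, v; split=> //; apply: (mulIf g0).
by rewrite mulrDl mul1r -!mulrA -aE -bE.
Qed.

Section CyclicMod.
Variables (M : lmodType R) (N : set M).
Hypotheses (N_sub : submod_set N) (N_sat : saturated N).

(** Saturation allows division by the gcd of [a] and [b]. The cofactors then satisfy
    [u * a' + v * b' = 1], and modulo [N] both [x] and [y] are multiples of [v *: x - u *: y]. *)
Lemma cyclic_mod2 (a b : R) (x y : M) : a != 0 -> N (a *: x + b *: y) ->
  exists u v r s, N (x - r *: (u *: x + v *: y)) /\ N (y - s *: (u *: x + v *: y)).
Proof.
move=> a0 Nab; have [g [a' [b' [u [v [aE bE g0 uv1]]]]]] := pid_bezout b a0.
have Nab' : N (a' *: x + b' *: y).
  by apply: (N_sat g0); rewrite scalerDr !scalerA mulrC -aE mulrC -bE.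
exists v, (- u), b', (- a'); split.
  rewrite (_ : _ - _ = u *: (a' *: x + b' *: y)); first exact: submodZ.
  rewrite !scalerDr !scalerA opprD addrA mulrN scaleNr opprK (mulrC b' u).
  by congr (_ + _); rewrite -[X in X - _]scale1r -scalerBl -uv1 (mulrC b') addrK.
rewrite (_ : _ - _ = v *: (a' *: x + b' *: y)); first exact: submodZ.
rewrite !scalerDr !scalerA opprD addrCA mulNr scaleNr opprK (mulrC a' v).
congr (_ + _); rewrite mulrN mulNr opprK -[X in X - _]scale1r -scalerBl -uv1.
by rewrite (mulrC a') addrC addKr.
Qed.

Definition seq_span (s : seq M) (v : M) : Prop :=
  exists c : nat -> R, v = \sum_(i < size s) c i *: s`_i.

Lemma seq_span_nil v : seq_span [::] v -> v = 0.
Proof. by case=> c ->; rewrite big_ord0. Qed.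

Lemma seq_span_cons t s v :
  seq_span (t :: s) v <-> exists r, seq_span s (v - r *: t).
Proof.
split=> [[c ->]|[r [c vE]]].
  by exists (c 0%N), (fun i => c i.+1); rewrite big_ord_recl addrC addKr.
exists (fun i => if i is i'.+1 then c i' else r).
by rewrite big_ord_recl /= -vE addrC subrK.
Qed.

Lemma seq_span_submod s : submod_set (seq_span s).
Proof.
split=> [|r _ _ [c ->] [c' ->]].
  by exists (fun=> 0); rewrite big1 // => i _; rewrite scale0r.
exists (fun i => r * c i + c' i); rewrite scaler_sumr -big_split /=.
by apply: eq_bigr => i _; rewrite scalerDl scalerA.
Qed.

(* Induction on the generators: modulo the span of [s], the elements of [D] are
   the multiples of one [v0], whose coefficient at [t] generates an ideal; the
   Bezout relation then merges [v0] with the generator found for [s]. *)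
Lemma rank1_cyclic (s : seq M) (D : set M) : submod_set D -> N `<=` D ->
    (forall x y, D x -> D y ->
      exists a b, (a != 0 \/ b != 0) /\ N (a *: x + b *: y)) ->
  exists e, D e /\ forall v, D v -> seq_span s v -> exists r, N (v - r *: e).
Proof.
move=> D_sub ND D_rank1; elim: s => [|t s [e [De eP]]].
  exists 0; split=> [|v _ /seq_span_nil ->]; first exact: D_sub.1.
  by exists 0; rewrite scaler0 subr0; apply: N_sub.1.
pose A r := exists2 v, D v & seq_span s (v - r *: t).
have s_sub := seq_span_submod s.
have [||c [v0 Dv0 v0P] cP] := @pid_ideal A.
- by exists 0; [exact: D_sub.1 | rewrite scale0r subr0; exact: s_sub.1].
- move=> r x y [v Dv vP] [w Dw wP]; exists (r *: v + w); first exact: D_sub.2.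
  have := s_sub.2 r _ _ vP wP.
  by rewrite scalerBr scalerA addrACA -opprD -scalerDl.
have [x [Dx [[r0 v0x] [r1 ex]]]] : exists x, D x /\
    (exists r, N (v0 - r *: x)) /\ (exists r, N (e - r *: x)).
  have [a [b [ab Nab]]] := D_rank1 _ _ Dv0 De.
  have Duv u v : D (u *: v0 + v *: e) by apply: D_sub.2 => //; exact: submodZ.
  case: ab => [a0|b0].
    have [u [v [r [q [Nx Ny]]]]] := cyclic_mod2 a0 Nab.
    by exists (u *: v0 + v *: e); split=> //; split; [exists r | exists q].
  rewrite addrC in Nab; have [u [v [r [q [Nx Ny]]]]] := cyclic_mod2 b0 Nab.
  exists (v *: v0 + u *: e); split=> //; rewrite addrC.
  by split; [exists q | exists r].
exists x; split=> // v Dv /seq_span_cons[r vr].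
have [q rE] : exists q, r = q * c by apply: cP; exists v.
have Dv' : D (v - q *: v0) by apply: submodB => //; exact: submodZ.
have [p Np] : exists p, N (v - q *: v0 - p *: e).
  apply: eP => //; have := s_sub.2 (- q) _ _ v0P vr.
  by rewrite scaleNr scalerBr scalerA -rE opprB addrC subrKA.
exists (q * r0 + p * r1).
have := submodD N_sub Np (submodD N_sub (submodZ N_sub q v0x) (submodZ N_sub p ex)).
by rewrite !scalerBr !scalerA (addrACA (q *: v0)) -opprD -scalerDl -(addrA v) -opprD subrKA.
Qed.

Lemma primitive_mod (M_fg : finitely_generated M) (x : M) : ~ N x ->
  exists e, [/\ ~ N e, exists s r, s != 0 /\ N (s *: e - r *: x) &
    forall (s r : R) v, s != 0 -> N (s *: v - r *: e) -> exists t, N (v - t *: e)].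
Proof.
move=> nNx; pose D v := exists s r : R, s != 0 /\ N (s *: v - r *: x).
have [gens gensP] := M_fg.
have gensP' v : seq_span gens v.
  have [c ->] := gensP v; exists (fun i => oapp c 0 (insub i)).
  by apply: eq_bigr => i _; rewrite valK.
have D_sub : submod_set D.
  split=> [|r u v [s1 [r1 [s10 N1]]] [s2 [r2 [s20 N2]]]].
    exists 1, 0; rewrite oner_eq0 scale0r subr0 scaler0.
    by split=> //; exact: N_sub.1.
  exists (s1 * s2), (r * s2 * r1 + s1 * r2); rewrite mulf_neq0 //; split=> //.
  have := submodD N_sub (submodZ N_sub (r * s2) N1) (submodZ N_sub s1 N2).
  rewrite !scalerBr !scalerA addrACA -opprD -scalerDl scalerDr scalerA.
  by rewrite (_ : r * s2 * s1 = s1 * s2 * r) // mulrC mulrA (mulrAC s1).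
have ND : N `<=` D.
  by move=> v Nv; exists 1, 0; rewrite oner_eq0 scale1r scale0r subr0.
have [|e [[s [r [s0 se]]] eP]] := rank1_cyclic gens D_sub ND.
  move=> u v [s1 [r1 [s10 N1]]] [s2 [r2 [s20 N2]]].
  have [r10|r10] := eqVneq r1 0.
    exists 1, 0; rewrite oner_eq0; split; first by left.
    rewrite scale0r addr0 scale1r; apply: (N_sat s10).
    by rewrite r10 scale0r subr0 in N1.
  exists (r2 * s1), (- (r1 * s2)); split; first by right; rewrite oppr_eq0 mulf_neq0.
  have := submodB N_sub (submodZ N_sub r2 N1) (submodZ N_sub r1 N2).
  by rewrite !scalerBr !scalerA (mulrC r2 r1) opprB subrKA scaleNr.
have Dx : D x by exists 1, 1; rewrite oner_eq0 subrr; split=> //; exact: N_sub.1.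
have [q xq] := eP x Dx (gensP' x).
exists e; split; [|by exists s, r|].
  move=> Ne; apply: nNx; rewrite -(subrK (q *: e) x).
  by apply: submodD => //; apply: submodZ.
move=> s' r' v s'0 Nv; apply: eP => //.
exists (s * s'), (r' * r); split; first exact: mulf_neq0.
have := submodD N_sub (submodZ N_sub s Nv) (submodZ N_sub r' se).
by rewrite !scalerBr !scalerA (mulrC r' s) subrKA.
Qed.

End CyclicMod.
End PrincipalIdeals.

(** * Bars *)

Section Transition.
Variables (R : nzRingType) (d : Order.disp_t) (I : porderType d).
Variable f : persistence_module R I.

(* Junk value: the zero map when [x <= y] fails. *)
Definition tr (x y : I) : {linear f x -> f y} :=
  match pselect (x <= y)%O with
  | left xy => pm_map f xy
  | right _ => (\0 : {linear f x -> f y})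
  end.

Lemma trE (x y : I) (xy : (x <= y)%O) v : tr x y v = pm_map f xy v.
Proof. by rewrite /tr; case: pselect => // xy'; rewrite (bool_irrelevance xy' xy). Qed.

Lemma tr_id (x : I) v : tr x x v = v.
Proof. by rewrite (trE (lexx x)) pm_map_id. Qed.

Lemma tr_comp (x y z : I) v : (x <= y)%O -> (y <= z)%O ->
  tr y z (tr x y v) = tr x z v.
Proof.
move=> xy yz; have xz := le_trans xy yz.
by rewrite (trE xy) (trE yz) (trE xz) (pm_map_comp xy yz xz).
Qed.

Lemma trD (x y : I) u v : tr x y (u + v) = tr x y u + tr x y v.
Proof. exact: linearD. Qed.

Lemma trB (x y : I) u v : tr x y (u - v) = tr x y u - tr x y v.
Proof. exact: linearB. Qed.

Lemma trZ (x y : I) r v : tr x y (r *: v) = r *: tr x y v.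
Proof. exact: linearZ. Qed.

End Transition.

Lemma range_submod (R : nzRingType) (U V : lmodType R) (g : {linear U -> V}) :
  submod_set (range g).
Proof.
split=> [|r _ _ [x _ <-] [y _ <-]]; first by exists 0; rewrite ?linear0.
by exists (r *: x + y); rewrite ?linearP.
Qed.

Lemma ker_submod (R : nzRingType) (U V : lmodType R) (g : {linear U -> V}) :
  submod_set [set v | g v = 0].
Proof.
split=> [|r u v /= u0 v0]; first exact: linear0.
by rewrite linearP u0 v0 scaler0 addr0.
Qed.

Section BarConstruction.
Variable R : idomainType.
Hypothesis R_pid : principal_ideal_domain R.
Variables (d : Order.disp_t) (I : orderType d) (f : persistence_module R I).
Hypothesis f_fg : forall x : I, finitely_generated (f x).
Hypothesis f_tf : forall x : I, saturated [set (0 : f x)].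
Hypothesis range_sat : forall x y : I, saturated (range (tr f x y)).

Local Notation tr := (tr f).

Lemma ker_sat (x y : I) : saturated [set v | tr x y v = 0].
Proof. by move=> r v r0 /=; rewrite trZ => /(f_tf r0). Qed.

(** * Lifting an element compatibly downwards *)

Section Lift.
Variables (a : I) (J : set I) (e : f a).
Hypothesis J_le : forall x, J x -> (x <= a)%O.
Hypothesis e_range : forall x, J x -> range (tr x a) e.

Let stable x : set (f x) := fun v => forall y, J y -> (y <= x)%O -> range (tr y x) v.

(** By the chain condition some [y] in [J] below [x] has a minimal image in [f x]. A lift of [v] to
    [f y], pushed to [x], lies in the images of all lower points of [J] as well, hence is stable. *)
Let stable_surj x u v : J x -> (x <= u)%O -> stable v ->
  exists w : f x, stable w /\ tr x u w = v.
Proof.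
move=> Jx xu v_st.
have [|y [[Jy yx] y_min]] := saturated_dcc (f_fg x)
    (P := fun y => J y /\ (y <= x)%O) (S := fun y => range (tr y x))
    (fun y => range_submod (tr y x)) (fun y => @range_sat y x).
  by exists x.
have [w _ wv] := v_st y Jy (le_trans yx xu).
exists (tr y x w); split; last by rewrite tr_comp.
move=> z Jz zx; have [zy|/ltW yz] := leP z y.
  apply: (y_min z) => //.
  by move=> _ [t _ <-]; exists (tr z y t); rewrite ?tr_comp.
by exists (tr y z w); rewrite ?tr_comp.
Qed.

Let stable_push x w (v : f w) : (w <= x)%O -> stable v -> stable (tr w x v).
Proof.
move=> wx v_st y Jy yx; have [yw|/ltW wy] := leP y w.
  by have [t _ <-] := v_st y Jy yw; exists t; rewrite ?tr_comp.
by exists (tr w y v); rewrite ?tr_comp.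
Qed.

Let point := {x : I & f x}.
Let compat (p q : point) := (tag p <= tag q)%O -> tr (tag p) (tag q) (tagged p) = tagged q.
Let top : point := Tagged (fun x => f x) e.
(** Partial lifts are encoded as graphs, so that Zorn's lemma applies to inclusion of sets. At equal
    tags [compat] reduces to equality, which makes the graph single-valued. *)
Let partial_lift (G : set point) :=
  [/\ forall p, G p -> J (tag p) /\ stable (tagged p),
      forall p, G p -> compat p top & forall p q, G p -> G q -> compat p q].

(* Either [x] lies above a point already reached, and the lift is transported from
   it, or all the points reached lie above [x]; then a lift of the one with the
   smallest kernel is a lift of all of them. *)
Lemma lift_extend (G : set point) x : partial_lift G -> J x ->
  exists v : f x, stable v /\ let p := Tagged (fun x => f x) v in
    [/\ compat p top, forall q, G q -> compat p q & forall q, G q -> compat q p].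
Proof.
move=> [GJ Gtop GG] Jx; have xa := J_le Jx.
have [[w [Gw wx]]|no_w] := pselect (exists w, G w /\ (tag w <= x)%O).
  exists (tr (tag w) x (tagged w)); split.
    by apply: stable_push => //; case: (GJ w Gw).
  have w_tr q : G q -> (x <= tag q)%O ->
      tr x (tag q) (tr (tag w) x (tagged w)) = tagged q.
    by move=> Gq xq; rewrite tr_comp //; apply: GG => //; exact: le_trans xq.
  split=> [_|q Gq xq|q Gq qx] /=; last 1 first.
  - have [qw|/ltW wq] := leP (tag q) (tag w).
      by rewrite -(GG q w Gq Gw qw) tr_comp.
    by rewrite -(GG w q Gw Gq wq) tr_comp.
  - by rewrite tr_comp //; apply: Gtop => //; exact: le_trans xa.
  - exact: w_tr.
pose U q := (G q \/ q = top) /\ (x <= tag q)%O.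
have UU p q : U p -> U q -> compat p q.
  move=> [[Gp|->] xp] [[Gq|->] xq] pq; [exact: GG|exact: Gtop| |exact: tr_id].
  have qa := J_le (GJ q Gq).1.
  have qe : tr (tag q) a (tagged q) = e := Gtop q Gq qa.
  by rewrite /= -[in LHS]qe tr_comp ?tr_id.
have U_st q : U q -> stable (tagged q).
  by move=> [[/GJ[]//|->] _] y Jy _; exact: e_range.
have [|u [Uu u_min]] := saturated_dcc (f_fg x) (P := U)
    (S := fun q => [set v | tr x (tag q) v = 0])
    (fun q => ker_submod (tr x (tag q))) (fun q => @ker_sat x (tag q)).
  by exists top; split; [right|].
have [v [v_st vu]] := stable_surj Jx Uu.2 (U_st u Uu).
have vU q : U q -> tr x (tag q) v = tagged q.
  move=> Uq; have [uq|/ltW qu] := leP (tag u) (tag q).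
    by rewrite -(UU u q Uu Uq uq) -vu tr_comp //; exact: Uu.2.
  (* As [q] lies below [u], minimality makes the kernels from [x] to [q] and to [u] equal. The lifts
     [v] and [v'] agree at [u], hence also at [q]. *)
  have [v' [_ vq]] := stable_surj Jx Uq.2 (U_st q Uq).
  rewrite -vq; apply/eqP; rewrite -subr_eq0 -trB; apply/eqP.
  apply: (u_min q Uq); last first.
    by rewrite /= trB vu -(UU q u Uq Uu qu) -vq tr_comp ?subrr //; exact: Uq.2.
  by move=> t /= t0; rewrite -(tr_comp _ Uq.2 qu) t0 linear0.
exists v; split=> //; split=> [_|q Gq xq|q Gq qx] /=.
- by apply: (vU top); split; [right|].
- by apply: (vU q); split; [left|].
- by case: no_w; exists q.
Qed.

(** By [lift_extend], a maximal partial lift meets every point of [J]; its compatibility with [top]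
    at [a] gives the value [e] there. *)
Lemma lift_below : J a ->
  exists g : forall x, f x, g a = e /\
    forall x y, J x -> J y -> (x <= y)%O -> tr x y (g x) = g y.
Proof.
move=> Ja; have [F FP Fchain|G [GP G_max]] := Zorn_bigcup (P := partial_lift).
  split=> [p [X FX Xp]|p [X FX Xp]|p q [X FX Xp] [Y FY Yq]].
  - by have [+ _ _] := FP X FX; exact.
  - by have [_ + _] := FP X FX; exact.
  - have [XY|YX] := Fchain _ _ FX FY.
      by have [_ _ YP] := FP Y FY; apply: YP => //; exact: XY.
    by have [_ _ XP] := FP X FX; apply: XP => //; exact: YX.
have [GJ Gtop GG] := GP.
have G_total x : exists v : f x, J x -> G (Tagged (fun x => f x) v).
  have [Jx|] := pselect (J x); last by exists 0.
  have [v [v_st [v_top vG Gv]]] := lift_extend GP Jx.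
  pose p : point := Tagged (fun x => f x) v.
  exists v => _; apply: contrapT => nGp.
  apply: (G_max (G `|` [set p])); first split.
  - exact: subsetUl.
  - by move=> /(_ p (or_intror erefl)).
  - split=> [q [/GJ//|->]|q [/Gtop//|->]|q q' [Gq|->] [Gq'|->]] //.
    + exact: GG.
    + exact: Gv.
    + exact: vG.
    + by move=> _; exact: tr_id.
pose g x := projT1 (cid (G_total x)).
have gG x : J x -> G (Tagged (fun x => f x) (g x)) by exact: projT2 (cid (G_total x)).
exists g; split=> [|x y Jx Jy]; last by exact: (GG _ _ (gG x Jx) (gG y Jy)).
by rewrite -[LHS](tr_id); exact: (Gtop _ (gG a Ja) (lexx a)).
Qed.

End Lift.

Definition bar (e : forall x, f x) : Prop :=
  forall x y, (x <= y)%O -> e x != 0 -> tr x y (e x) = e y.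

(* [pure_sat] and [pure_sum_sat] say that [f / N] has torsion-free values and
   saturated images; by [pure_range], an element of [f / N] killed by a
   transition map lifts to an element of [f] killed by the same map.  All the
   conditions are elementwise, hence inherited by unions of chains. *)
Record pure (N : forall x, set (f x)) : Prop := Pure {
  pure_submod : forall x, submod_set (N x);
  pure_stable : forall x y v, (x <= y)%O -> N x v -> N y (tr x y v);
  pure_sat : forall x, saturated (N x);
  pure_range : forall x y v, (x <= y)%O -> N y (tr x y v) ->
    exists n, N x n /\ tr x y v = tr x y n;
  pure_sum_sat : forall x y (s : R) v w, (x <= y)%O -> s != 0 ->
    N y (s *: v - tr x y w) -> exists w', N y (v - tr x y w') }.

(** * Extending a pure family by one bar *)

Section NewBar.
Variable N : forall x, set (f x).
Hypothesis N_pure : pure N.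

Let N_sub := pure_submod N_pure.

(** In the quotient by [N]: a nonzero element spanning a saturated line. *)
Definition primitive x (e : f x) : Prop := ~ N e /\
  forall (s r : R) v, s != 0 -> N (s *: v - r *: e) -> exists t, N (v - t *: e).

Lemma primitive_congr x (e e' : f x) : N (e - e') -> primitive e -> primitive e'.
Proof.
move=> Nee [nNe e_prim]; split=> [Ne'|s r v s0 Nv].
  by apply: nNe; apply: submod_congr Ne'.
have Nre r' : N (r' *: e' - r' *: e).
  by rewrite -scalerBr; apply: submodZ => //; exact: submodBC.
have [t Nt] := e_prim s r v s0 (submod_trans (N_sub x) Nv (Nre r)).
by exists t; exact: (submod_trans (N_sub x) Nt (submodBC (N_sub x) (Nre t))).
Qed.

(** The last two fields keep the enlarged span pure. At a point above [a] where the bar is alive,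
    relations modulo [N] between elements coming from [x0] can be read off at [a]; from a point
    below [a] where the bar is zero, nothing survives at [a] modulo [N]. *)
Record adapted_bar (a : I) (e : forall x, f x) : Prop := AdaptedBar {
  adapted_bar_bar : bar e;
  adapted_bar_prim : primitive (e a);
  adapted_bar_above : exists x0 w0, [/\ (x0 <= a)%O, e a = tr x0 a w0 &
    forall y, (a <= y)%O -> e y != 0 ->
      forall w, N (tr x0 y w) -> N (tr x0 a w)];
  adapted_bar_below : forall x, (x <= a)%O -> e x = 0 -> forall w, N (tr x a w) }.

(** The chain condition gives a minimal image. Since [I] is totally ordered, the images in [f a] are
    nested, so a minimal one is smallest. *)
Lemma exists_smallest_range (a : I) (v0 : f a) : ~ N v0 ->
  exists x0, [/\ (x0 <= a)%O, exists w, ~ N (tr x0 a w) &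
    forall x, (x <= a)%O -> (exists w, ~ N (tr x a w)) ->
      range (tr x0 a) `<=` range (tr x a)].
Proof.
move=> nNv0; have [|x0 [[x0a x0N] x0_min]] := saturated_dcc (f_fg a)
    (P := fun x => (x <= a)%O /\ exists w, ~ N (tr x a w))
    (S := fun x => range (tr x a))
    (fun x => range_submod (tr x a)) (fun x => @range_sat x a).
  by exists a; split=> //; exists v0; rewrite tr_id.
exists x0; split=> // x xa xN; have [xx0|/ltW x0x] := leP x x0.
  by apply: x0_min => // _ [t _ <-]; exists (tr x x0 t); rewrite ?tr_comp.
by move=> _ [t _ <-]; exists (tr x0 x t); rewrite ?tr_comp.
Qed.

(* At [y], the image of [x0] in [f a] acquires new kernel modulo [N]. *)
Definition loses (a x0 y : I) : Prop :=
  (a <= y)%O /\ exists w, N (tr x0 y w) /\ ~ N (tr x0 a w).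

(** Let [y0] be the losing point with smallest kernel on [f a]. What dies at [y0] dies at every
    losing point, and [pure_range] at [y0] corrects an element that falls into [N] there to one that
    dies there. *)
Lemma exists_killed (a x0 : I) : (x0 <= a)%O -> (exists w, ~ N (tr x0 a w)) ->
  (exists w, ~ N (tr x0 a w) /\ forall y, loses a x0 y -> tr x0 y w = 0) /\
  (forall w, (forall y, loses a x0 y -> N (tr x0 y w)) ->
    exists n, N n /\ forall y, loses a x0 y -> tr x0 y (w - n) = 0).
Proof.
pose Q := loses a x0; move=> x0a [w0 nNw0]; have [Qn0|Q0] := pselect (Q !=set0); last first.
  have noQ y : ~ Q y by move=> Qy; apply: Q0; exists y.
  split; first by exists w0; split=> // y /noQ.
  by move=> w _; exists 0; split=> [|y /noQ//]; exact: (N_sub x0).1.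
have [y0 [Qy0 y0_min]] := saturated_dcc (f_fg a)
    (S := fun y => [set v | tr a y v = 0])
    (fun y => ker_submod (tr a y)) (fun y => @ker_sat a y) Qn0.
have ay0 := Qy0.1; have x0y0 := le_trans x0a ay0.
have killQ w : tr x0 y0 w = 0 -> forall y, Q y -> tr x0 y w = 0.
  move=> w0' y [ay Qy]; rewrite -(tr_comp _ x0a ay).
  have [y0y|/ltW yy0] := leP y0 y.
    by rewrite (tr_comp _ x0a ay) -(tr_comp _ x0y0 y0y) w0' linear0.
  apply: (y0_min y); [by split | |by rewrite /= tr_comp].
  by move=> t /= t0; rewrite -(tr_comp _ ay yy0) t0 linear0.
have kill w : N (tr x0 y0 w) -> exists n, N n /\ forall y, Q y -> tr x0 y (w - n) = 0.
  move=> /(pure_range N_pure x0y0)[n [Nn wn]]; exists n; split=> //.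
  by apply: killQ; rewrite trB wn subrr.
split; last by move=> w Qw; apply/kill/Qw.
have [_ [w [Nw nNw]]] := Qy0; have [n [Nn wn]] := kill w Nw.
exists (w - n); split=> // Nwn; apply: nNw; rewrite -(subrK n w) trD.
by apply: submodD => //; apply: (pure_stable N_pure).
Qed.

Lemma exists_adapted_bar (a : I) (v0 : f a) : ~ N v0 -> exists e, adapted_bar a e.
Proof.
move=> /exists_smallest_range[x0 [x0a x0N x0_min]].
have [[y1 [nNy1 y1_kill]] kill] := exists_killed x0a x0N.
have [e0 [nNe0 [s [r [s0 se0]]] e0_prim]] :=
  primitive_mod R_pid (N_sub a) (@pure_sat _ N_pure a) (f_fg a) nNy1.
have [w' Nw'] : exists w', N (e0 - tr x0 a w').
  by apply: (pure_sum_sat N_pure (s := s) (w := r *: y1)) => //; rewrite trZ.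
(* At [a], [s *: w'] agrees with [r *: y1] modulo [N]. Since [y1] dies at each losing [y],
   saturation puts [w'] into [N] there, so [kill] applies. *)
have [y Qy|n [Nn n_kill]] := kill w'.
  have [ay _] := Qy; apply: (pure_sat N_pure s0).
  rewrite -[s *: _]subr0 -(scaler0 _ r) -(y1_kill y Qy).
  have Na : N (tr x0 a (s *: w' - r *: y1)).
    rewrite trB !trZ; apply: (submod_trans (N_sub a) _ se0).
    by rewrite -scalerBr; apply: submodZ => //; exact: submodBC.
  by have := pure_stable N_pure ay Na; rewrite tr_comp // trB !trZ.
set w := w' - n in n_kill; set ea := tr x0 a w.
have ea_prim : primitive ea.
  apply: primitive_congr (conj nNe0 e0_prim).
 apply: (submod_trans (N_sub a) Nw').
  by rewrite -trB subKr; apply: (pure_stable N_pure).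
have ea0 : ea <> 0 by move=> ea0; case: ea_prim; rewrite ea0 => + _; apply; exact: (N_sub a).1.
(* [J] is the support of the new bar below [a]. By the choice of [x0], the image of [x0] in [f a]
   lies in the image of every point of [J], so [ea] lifts to all of them. *)
pose J x := (x <= a)%O /\ exists v, ~ N (tr x a v).
have Ja : J a by split=> //; exists ea; rewrite tr_id; case: ea_prim.
have [||g [ga gJ]] := @lift_below a J ea _ _ Ja.
- by move=> x [].
- by move=> x [xa xJ]; apply: (x0_min x xa xJ); exists w.
pose e x := if (x <= a)%O then if `[< J x >] then g x else 0 else tr a x ea.
have e_above y : (a <= y)%O -> e y = tr a y ea.
  rewrite /e => ay; have [ya|//] := boolP (y <= a)%O.
  have ya_eq : y = a by apply/eqP; rewrite eq_le ya.
  by rewrite ya_eq asboolT // ga tr_id.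
have e_below x : (x <= a)%O -> J x -> e x = g x by rewrite /e => -> Jx; rewrite asboolT.
have e0J x : (x <= a)%O -> e x != 0 -> J x.
  by rewrite /e => ->; case: asboolP => //; rewrite eqxx.
have tr_e x : (x <= a)%O -> J x -> tr x a (e x) = ea.
  by move=> xa Jx; rewrite e_below // gJ.
have e_a : e a = ea by rewrite e_above ?tr_id.
exists e; split.
- move=> x y xy ex; have [xa|/ltW ax] := leP x a; last first.
    by rewrite !e_above ?tr_comp //; exact: le_trans xy.
  have Jx := e0J x xa ex; have [ya|/ltW ay] := leP y a.
    have Jy : J y.
      by split=> //; case: Jx => _ [v Nv]; exists (tr x y v); rewrite tr_comp.
    by rewrite !e_below // gJ.
  by rewrite (e_above y) // -(tr_comp _ xa ay) tr_e.
- by rewrite e_a.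
(* If [v] were new kernel at [y], then [y] would be a losing point, where [w] dies, against
   [e y != 0]. *)
- exists x0, w; split=> // y ay ey v Nv; apply: contrapT => nNv.
  case/eqP: ey; rewrite e_above // tr_comp //.
  by apply: n_kill; split=> //; exists v.
- move=> x xa ex v; apply: contrapT => nNv; apply: ea0.
  by rewrite -(tr_e x xa) ?ex ?linear0 //; split=> //; exists v.
Qed.

Definition add_line (e : forall x, f x) x : set (f x) :=
  fun v => exists r, N (v - r *: e x).

Arguments add_line e x _ : clear implicits.

(** Membership in [N] below [a] would move up to [a] by stability, and above [a] it would be pulled
    back to [a] through [x0]; either way it contradicts primitivity. *)
Lemma adapted_bar_notin a e : adapted_bar a e -> forall y, e y != 0 -> ~ N (e y).
Proof.
move=> [e_bar [nNea _] [x0 [w0 [x0a eaE ea_above]]] _] y ey Ny.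
have ea0 : e a != 0.
  by apply/eqP => ea0; apply: nNea; rewrite ea0; exact: (N_sub a).1.
apply: nNea.
have [ya|/ltW ay] := leP y a.
  by rewrite -(e_bar y a ya ey); apply: (pure_stable N_pure).
rewrite eaE; apply: (ea_above y ay ey).
by rewrite -(tr_comp _ x0a ay) -eaE (e_bar a y).
Qed.

(** For [x <= y] there are three cases ([e_tr]): the bar is zero at [y], it is alive at [x], or it
    is born after [x]. In the first two the multiple of [e y] vanishes or comes from [x], and purity
    of [N] suffices; in the third the relation is examined through [a]. *)
Lemma adapted_bar_pure a e : adapted_bar a e -> pure (add_line e).
Proof.
move=> e_adapted; have [e_bar [nNea e_prim] [x0 [w0 [x0a eaE ea_above]]] e_below] := e_adapted.
have ea0 : e a != 0.
  by apply/eqP => ea0; apply: nNea; rewrite ea0; exact: (N_sub a).1.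
have addN x v : N v -> add_line e x v.
  by move=> Nv; exists 0; rewrite scale0r subr0.
have e_tr x y : (x <= y)%O -> e y = 0 \/ e x != 0 \/ (x <= a)%O /\ e x = 0 /\ e y != 0.
  move=> xy; have [|ey] := eqVneq (e y) 0; first by left.
  have [ex|] := eqVneq (e x) 0; last by right; left.
  right; right; split=> //; rewrite leNgt; apply/negP => /ltW ax.
  case/eqP: ey; rewrite -(e_bar a y) ?(le_trans ax) // -(tr_comp _ ax xy).
  by rewrite (e_bar a x) // ex linear0.
have coef0 (r : R) : N (r *: e a) -> r = 0.
  move=> Nr; apply/eqP/negPn/negP => r0; apply: nNea.
  exact: (pure_sat N_pure r0).
have prim_le y : (y <= a)%O -> e y != 0 -> forall (s r : R) v, s != 0 ->
    N (s *: tr y a v - r *: e a) -> exists t, N (tr y a v - t *: e a) /\ r = s * t.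
  move=> ya ey s r v s0 Nv; have [t Nt] := e_prim s r _ s0 Nv.
  exists t; split=> //; apply/eqP; rewrite -subr_eq0; apply/eqP/coef0.
  rewrite scalerBl -scalerA; apply: (submod_trans (N_sub a) (submodBC (N_sub a) Nv)).
  by rewrite -scalerBr; apply: submodZ.
have line_sat x : saturated (add_line e x).
  move=> s v s0 [r Nv]; have [ex|ex] := eqVneq (e x) 0.
    by apply: addN; apply: (pure_sat N_pure s0); rewrite ex scaler0 subr0 in Nv.
  have [xa|/ltW ax] := leP x a.
    have Na : N (s *: tr x a v - r *: e a).
      have := pure_stable N_pure xa Nv.
      by rewrite trB !trZ (e_bar x a).
    have [t [_ rE]] := prim_le x xa ex s r v s0 Na; exists t.
    by apply: (pure_sat N_pure s0); rewrite scalerBr scalerA -rE.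
  (* Above [a] the relation is first lifted to [x0], then read at [a], where [e a] is primitive, and
     the result is transported back to [x]. *)
  have exE : e x = tr x0 x w0 by rewrite -(tr_comp _ x0a ax) -eaE (e_bar a x).
  have x0x := le_trans x0a ax.
  have [w Nw] : exists w, N (v - tr x0 x w).
    by apply: (pure_sum_sat N_pure (s := s) (w := r *: w0)) => //; rewrite trZ -exE.
  have [t Nt] : exists t, N (tr x0 a w - t *: e a).
    apply: (e_prim s r) => //; rewrite eaE -!trZ -trB.
    apply: (ea_above x ax ex); rewrite trB !trZ -exE.
    apply: (submod_trans (N_sub x) _ Nv); rewrite -scalerBr; apply: submodZ => //.
    exact: submodBC.
  exists t; apply: (submod_trans (N_sub x) Nw).
  have := pure_stable N_pure ax Nt.
  by rewrite trB trZ (e_bar a x) // tr_comp.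
split=> //.
- move=> x; split=> [|r u v [r1 N1] [r2 N2]]; first exact/addN/(N_sub x).1.
  exists (r * r1 + r2); have := submodD (N_sub x) (submodZ (N_sub x) r N1) N2.
  by rewrite scalerBr scalerA addrACA -opprD -scalerDl.
- move=> x y v xy [r Nv]; have := pure_stable N_pure xy Nv; rewrite trB trZ.
  have [->|ex] := eqVneq (e x) 0.
    by rewrite linear0 scaler0 subr0 => /addN.
  by rewrite (e_bar x y) // => Ny; exists r.
- move=> x y v xy [r Nv].
  have [n [Nn vn]] : exists n, add_line e x n /\ tr x y v = tr x y n; last by exists n.
  have via t : N (tr x y (v - t *: e x)) ->
      exists n, add_line e x n /\ tr x y v = tr x y n.
    move=> /(pure_range N_pure xy)[n [Nn vn]]; exists (n + t *: e x).
    by split; [exists t; rewrite addrK | rewrite trD -vn trB subrK].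
  have [ey|[ex|[xa [ex ey]]]] := e_tr x y xy.
  + by apply: (via 0); rewrite ey scaler0 subr0 in Nv; rewrite scale0r subr0.
  + by apply: (via r); rewrite trB trZ (e_bar x y).
  (* All of [f x] maps into [N] at [a]. For [y] below [a] this forces [r = 0]; for [y] above [a] it
     already places [tr x y v] in [N]. *)
  + apply: (via 0); rewrite scale0r subr0; have [ya|/ltW ay] := leP y a.
      have := pure_stable N_pure ya Nv.
      rewrite trB trZ (e_bar y a) // tr_comp // => Na.
      have r0 : r = 0.
        apply: coef0; rewrite -[_ *: _](subKr (tr x a v)); apply: submodB => //.
        exact: e_below.
      by rewrite r0 scale0r subr0 in Nv.
    by rewrite -(tr_comp _ xa ay); apply: (pure_stable N_pure ay); apply: e_below.
- move=> x y s v w xy s0 [r Nv].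
  have [ey|[ex|[xa [ex ey]]]] := e_tr x y xy.
  + rewrite ey scaler0 subr0 in Nv.
    by have [w' Nw'] := pure_sum_sat N_pure xy s0 Nv; exists w'; apply: addN.
  + have [|w' Nw'] := pure_sum_sat N_pure (w := w + r *: e x) xy s0 (v := v).
      by rewrite trD trZ (e_bar x y) // opprD addrA.
    by exists w'; apply: addN.
  (* If [a <= y], the term from [w] is absorbed by [N] and [line_sat] applies. If [y <= a],
     comparison at [a] shows that [s] divides [r], so a multiple of [e y] can be split off. *)
  + have [ya|/ltW ay] := leP y a; last first.
      have [t Nt] : exists t, N (v - t *: e y).
        apply: (line_sat y s v s0); exists r.
        have := submodD (N_sub y) Nv (pure_stable N_pure ay (e_below x xa ex w)).
        by rewrite tr_comp // addrAC subrK.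
      by exists 0; rewrite linear0 subr0; exists t.
    have Na : N (s *: tr y a v - r *: e a).
      have := submodD (N_sub a) (pure_stable N_pure ya Nv) (e_below x xa ex w).
      by rewrite !trB !trZ (e_bar y a) // tr_comp // addrAC subrK.
    have [t [_ rE]] := prim_le y ya ey s r v s0 Na.
    have [|w' Nw'] := pure_sum_sat N_pure (w := w) xy s0 (v := v - t *: e y).
      by rewrite scalerBr scalerA -rE addrAC.
    by exists w', t; rewrite addrAC.
Qed.

End NewBar.

(** * Independent sets of bars and Zorn's lemma *)

Definition barT := {classic (forall x, f x)}.

Inductive bar_span (B : set barT) (x : I) : f x -> Prop :=
| bar_span0 : bar_span B 0
| bar_span_add (r : R) (e : barT) v of B e & bar_span B v :
    bar_span B (r *: e x + v).

Arguments bar_span B x _ : clear implicits.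

(** The conclusion concerns [c e *: e x] and not [c e], since a bar may vanish at [x]. *)
Definition independent_bars (B : set barT) : Prop :=
  forall (x : I) (s : seq barT) (c : barT -> R), uniq s -> [set` s] `<=` B ->
    \sum_(e <- s) c e *: e x = 0 -> forall e, e \in s -> c e *: e x = 0.

Lemma bar_span_mem (B : set barT) (e : barT) x : B e -> bar_span B x (e x).
Proof.
by move=> Be; rewrite -[e x]addr0 -{1}[e x]scale1r; apply: bar_span_add => //; exact: bar_span0.
Qed.

Lemma bar_span_submod (B : set barT) x : submod_set (bar_span B x).
Proof.
split=> [|r u v Bu Bv]; first exact: bar_span0.
elim: Bu => [|r' e u' Be _ IH]; first by rewrite scaler0 add0r.
by rewrite scalerDr scalerA -addrA; apply: bar_span_add.
Qed.

Lemma bar_span_sum (B : set barT) x (s : seq barT) (c : barT -> R) :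
  [set` s] `<=` B -> bar_span B x (\sum_(e <- s) c e *: e x).
Proof.
move=> sB; rewrite big_seq; apply: big_ind => [|u v|e /sB Be].
- exact: bar_span0.
- exact: (submodD (bar_span_submod B x)).
- by apply: (submodZ (bar_span_submod B x)); apply: bar_span_mem.
Qed.

Lemma bar_span_seq (B : set barT) x v : bar_span B x v ->
  exists (s : seq barT) (c : barT -> R),
    [/\ uniq s, [set` s] `<=` B & v = \sum_(e <- s) c e *: e x].
Proof.
elim=> [|r e {}v Be _ [s [c [s_uniq sB ->]]]].
  by exists [::], (fun=> 0); split=> //; rewrite big_nil.
have [es|es] := boolP (e \in s).
  exists s, (fun e' => (if e' == e then r else 0) + c e'); split=> //.
  rewrite (bigD1_seq e) // [in RHS](bigD1_seq e) //= eqxx scalerDl addrA.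
  by congr (_ + _); apply: eq_bigr => e' /negPf ->; rewrite add0r.
exists (e :: s), (fun e' => if e' == e then r else c e'); split.
- by rewrite /= es.
- by move=> e' /=; rewrite inE => /orP[/eqP ->//|]; exact: sB.
- rewrite big_cons eqxx; congr (_ + _); apply: eq_big_seq => e' e's.
  by case: eqP => // e'e; rewrite -e'e e's in es.
Qed.

Lemma bar_spanS (B C : set barT) x : B `<=` C -> bar_span B x `<=` bar_span C x.
Proof.
by move=> BC v; elim=> [|r e u /BC Ce _ IH]; [exact: bar_span0 | exact: bar_span_add].
Qed.

Lemma bar_span_stable (B : set barT) : (forall e, B e -> bar e) ->
  forall x y v, (x <= y)%O -> bar_span B x v -> bar_span B y (tr x y v).
Proof.
move=> B_bar x y v xy; elim=> [|r e u Be _ IH]; first by rewrite linear0; exact: bar_span0.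
rewrite trD trZ; apply: (submodD (bar_span_submod B y)) => //.
apply: (submodZ (bar_span_submod B y)).
have [->|ex] := eqVneq (e x) 0; first by rewrite linear0; exact: bar_span0.
by rewrite (B_bar e Be x y) //; apply: bar_span_mem.
Qed.

Lemma bar_span_setU1 (B : set barT) (e : barT) :
  bar_span (B `|` [set e]) = add_line (bar_span B) e.
Proof.
apply: functional_extensionality_dep => x; apply/seteqP; split=> v /=.
  elim=> [|r e' u [Be'|->] _ [t IH]].
  - by exists 0; rewrite scale0r subr0; exact: bar_span0.
  - by exists t; rewrite -addrA; apply: bar_span_add.
  - by exists (r + t); rewrite scalerDl opprD addrACA subrr add0r.
move=> [r vr]; rewrite -(subrK (r *: e x) v) addrC; apply: bar_span_add; first by right.
by apply: bar_spanS vr; exact: subsetUl.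
Qed.

Let good (B : set barT) : Prop :=
  [/\ forall e, B e -> bar e, independent_bars B & pure (bar_span B)].

(** Purity of the zero family amounts to torsion-free values and saturated images of [f]. *)
Let good_set0 : good set0.
Proof.
have span0E x v : bar_span set0 x v -> v = 0 by case.
split=> // [x s c _ s0 _ e /s0//|]; split.
- exact: bar_span_submod.
- exact: bar_span_stable.
- move=> x r v r0 /span0E rv; have -> : v = 0 by exact: (f_tf r0).
  exact: bar_span0.
- by move=> x y v xy /span0E ->; exists 0; rewrite linear0; split=> //; exact: bar_span0.
- move=> x y s v w xy s0 /span0E/eqP; rewrite subr_eq0 => /eqP svw.
  have [w' _ <-] : range (tr x y) v by apply: (range_sat s0); exists w.
  by exists w'; rewrite subrr; exact: bar_span0.
Qed.

Let good_bigcup (F : set (set barT)) : F `<=` good -> total_on F subset ->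
  good (\bigcup_(X in F) X).
Proof.
move=> FG F_tot; set U := \bigcup_(X in F) X.
(* Finitely many bars of the union lie in one member of the chain. The empty list is separate
   because the chain may be empty; [set0] then serves. *)
have seq_in (s : seq barT) : [set` s] `<=` U ->
    exists X, [/\ good X, X `<=` U & [set` s] `<=` X].
  move=> sU; suff [->|[X FX sX]] : s = [::] \/ exists2 X, F X & [set` s] `<=` X.
  - by exists set0; split=> //; exact: sub0set.
  - by exists X; split=> //; [exact: FG | exact: bigcup_sup].
  elim: s sU => [|e s IH] sU; [by left | right].
  have [Y FY Ye] := sU e (mem_head e s).
  have [|->|[X FX sX]] := IH; first by move=> e' e's; apply: sU; rewrite /= inE e's orbT.
    by exists Y => // e' /=; rewrite inE => /eqP ->.
  have [XY|YX] := F_tot _ _ FX FY.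
    by exists Y => // e' /=; rewrite inE => /orP[/eqP ->//|/sX/XY].
  by exists X => // e' /=; rewrite inE => /orP[/eqP ->|/sX//]; exact: YX.
have span_in x v : bar_span U x v ->
    exists X, [/\ good X, X `<=` U & bar_span X x v].
  move=> /bar_span_seq[s [c [_ /seq_in[X [XG XU sX]] ->]]].
  by exists X; split=> //; exact: bar_span_sum.
have U_bar e : U e -> bar e by move=> [X /FG[X_bar _ _] Xe]; exact: X_bar.
split=> // [x s c s_uniq /seq_in[X [[_ X_ind _] _ sX]]|]; first exact: X_ind.
split.
- exact: bar_span_submod.
- exact: bar_span_stable.
- move=> x r v r0 /span_in[X [[_ _ X_pure] XU Xrv]].
  exact: bar_spanS XU _ (pure_sat X_pure r0 Xrv).
- move=> x y v xy /span_in[X [[_ _ X_pure] XU Xv]].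
  have [n [Xn vn]] := pure_range X_pure xy Xv.
  by exists n; split=> //; exact: bar_spanS XU _ Xn.
- move=> x y s v w xy s0 /span_in[X [[_ _ X_pure] XU Xvw]].
  have [w' Xw'] := pure_sum_sat X_pure xy s0 Xvw.
  by exists w'; exact: bar_spanS XU _ Xw'.
Qed.

Lemma exists_bar_basis : exists B : set barT,
  [/\ forall e, B e -> bar e, independent_bars B & forall x v, bar_span B x v].
Proof.
have [B [[B_bar B_ind B_pure] B_max]] := Zorn_bigcup good_bigcup.
exists B; split=> // a v0; apply: contrapT => nv0.
have [e e_ad] := exists_adapted_bar B_pure nv0.
have nBea : ~ bar_span B a (e a) := (adapted_bar_prim e_ad).1.
apply: (B_max (B `|` [set (e : barT)])).
  split; first exact: subsetUl.
  by move=> /(_ e (or_intror erefl)) Be; apply: nBea; exact: bar_span_mem.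
split.
- by move=> e' [/B_bar//|->]; exact: adapted_bar_bar e_ad.
- move=> x s c s_uniq sB s0.
  have [es|es] := boolP ((e : barT) \in s); last first.
    apply: B_ind => // e' e's; case: (sB e' e's) => // e'e.
    by rewrite -e'e e's in es.
  have rB : [set` rem (e : barT) s] `<=` B.
    move=> e' /=; rewrite mem_rem_uniq // !inE => /andP[e'e e's].
    by case: (sB e' e's) => // /eqP; rewrite (negPf e'e).
  move: s0; rewrite (perm_big _ (perm_to_rem es)) big_cons /= => s0.
  (* Otherwise saturation would put [e x] in the span of [B], against [adapted_bar_notin]. *)
  have ce : c e *: e x = 0.
    have [->|ex] := eqVneq (e x) 0; first exact: scaler0.
    have [->|c0] := eqVneq (c e) 0; first exact: scale0r.
    case: (adapted_bar_notin B_pure e_ad ex); apply: (pure_sat B_pure c0).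
    have -> : c e *: e x = - \sum_(e' <- rem (e : barT) s) c e' *: e' x.
      by apply/eqP; rewrite -addr_eq0 s0.
    by apply: (submodN (bar_span_submod B x)); apply: bar_span_sum.
  move=> e' e's; have [->//|e'e] := eqVneq e' (e : barT).
  apply: (B_ind x (rem (e : barT) s)); rewrite ?rem_uniq ?mem_rem_uniq ?inE ?e'e //.
  by rewrite ce add0r in s0.
- by rewrite bar_span_setU1; exact: (adapted_bar_pure B_pure e_ad).
Qed.

End BarConstruction.

(** * Interval submodules and cokernels *)

Section FamilySums.
Variables (R : nzRingType) (V : lmodType R) (K : choiceType).

Lemma finite_supportE (v : K -> V) :
  finite_set [set k | v k != 0] <-> exists s : seq K, forall k, k \notin s -> v k = 0.
Proof.
split=> [/finite_seqP[s sE]|[s sP]].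
  exists s => k; apply: contraNeq => vk.
  by have : [set k | v k != 0] k by []; rewrite sE.
apply: (sub_finite_set _ (finite_seq s)) => k /=.
by apply: contraR => /sP ->.
Qed.

Lemma fsum_seq (v : K -> V) (s : seq K) : (forall k, k \notin s -> v k = 0) ->
  \sum_(k \in [set: K]) v k = \sum_(k <- undup s) v k.
Proof.
move=> sP; rewrite (fsbigE (undup s)) ?undup_uniq //.
  by apply: eq_bigl => k; rewrite mem_set.
by move=> k _; rewrite mem_undup; exact: sP.
Qed.

End FamilySums.

(** If [c] gives the coordinates of [v], then [r * c] and 0 both give coordinates of [r *: v = 0],
    so uniqueness makes [c] vanish. *)
Lemma free_torsionfree (R : idomainType) (V : lmodType R) :
  free_module V -> saturated [set (0 : V)].
Proof.
move=> [K [e e_basis]] r v r0 /= rv0.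
have [c [[/(@finite_supportE _ R^o)[s sP] vE] _]] := e_basis v.
have [z [_ z_uniq]] := e_basis 0.
have zc : z = (fun k => r * c k).
  apply: z_uniq; split.
    by apply/(@finite_supportE _ R^o); exists s => k /sP /= ->; rewrite mulr0.
  have -> : \sum_(k \in [set: K]) (r * c k) *: e k = \sum_(k <- undup s) (r * c k) *: e k.
    by apply: fsum_seq => k /sP ->; rewrite mulr0 scale0r.
  rewrite -[LHS]rv0 vE (fsum_seq (s := s)) => [|k /sP ->]; last by rewrite scale0r.
  by rewrite scaler_sumr; apply: eq_bigr => k _; rewrite scalerA.
have z0 : z = (fun=> 0).
  apply: z_uniq; split.
    by apply/(@finite_supportE _ R^o); exists [::].
  by rewrite (fsum_seq (s := [::])) ?big_nil // => k _; rewrite scale0r.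
rewrite vE (fsum_seq (s := s)) => [|k /sP ->]; last by rewrite scale0r.
apply: big1 => k _; have /eqP : r * c k = 0 by rewrite -[LHS]/((fun k => r * c k) k) -zc z0.
by rewrite mulf_eq0 (negPf r0) /= => /eqP ->; rewrite scale0r.
Qed.

(** * Cokernels and saturated images *)

Section CokernelProjection.
Variables (R : nzRingType) (U V : lmodType R) (g : {linear U -> V}).
Local Open Scope quotient_scope.

Definition coker_proj (v : V) : cokernel g :=
  \pi_(quotient_module (image_pred g)) v.

Lemma coker_proj_is_linear : linear coker_proj.
Proof.
move=> r u v; rewrite /coker_proj.
have -> : r *: (\pi_(quotient_module (image_pred g)) u : cokernel g) =
    \pi_(quotient_module (image_pred g)) (r *: u) by exact: pi_scale.
by rewrite !piE.
Qed.

HB.instance Definition _ :=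
  GRing.isLinear.Build R V (cokernel g) _ coker_proj coker_proj_is_linear.

Lemma coker_proj_eq0 v : coker_proj v = 0 <-> range g v.
Proof.
have <- : coker_proj 0 = 0 by exact: linear0.
split=> [/eqP|[w _ wv]]; last apply/eqP.
  rewrite /coker_proj -Quotient.idealrBE subr0 => /asboolP[w wv].
  by exists w.
by rewrite /coker_proj -Quotient.idealrBE subr0; apply/asboolP; exists w.
Qed.

Lemma coker_proj_surj y : exists v, y = coker_proj v.
Proof. by exists (repr y); rewrite /coker_proj reprK. Qed.

End CokernelProjection.

Lemma coker_free_range_saturated (R : idomainType) (U V : lmodType R)
    (g : {linear U -> V}) :
  free_module (cokernel g) -> saturated (range g).
Proof.
move=> /free_torsionfree tf r v r0 rv; apply/coker_proj_eq0/(tf r) => //.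
by rewrite /= -linearZ; apply/coker_proj_eq0.
Qed.

Definition cyclic (R : nzRingType) (V : lmodType R) (u : V) : {pred V} :=
  fun v => `[< exists r : R, v = r *: u >].

Lemma cyclicP (R : nzRingType) (V : lmodType R) (u v : V) :
  reflect (exists r : R, v = r *: u) (v \in cyclic u).
Proof. exact: asboolP. Qed.

Section CyclicClosed.
Variables (R : nzRingType) (V : lmodType R) (u : V).

Lemma cyclic_submod_closed : submod_closed (cyclic u).
Proof.
split=> [|r v w /cyclicP[s ->] /cyclicP[t ->]]; apply/cyclicP.
  by exists 0; rewrite scale0r.
by exists (r * s + t); rewrite scalerDl scalerA.
Qed.

HB.instance Definition _ := GRing.isSubmodClosed.Build R V (cyclic u)
  (GRing.submod_closed_semi cyclic_submod_closed).

End CyclicClosed.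

Lemma linear_inverse (R : nzRingType) (U V : lmodType R) (g : {linear U -> V}) :
    injective g -> (forall v, exists u, g u = v) ->
  exists h : {linear V -> U}, cancel g h /\ cancel h g.
Proof.
move=> g_inj g_surj; pose h v := projT1 (cid (g_surj v)).
have hK : cancel h g by move=> v; exact: projT2 (cid (g_surj v)).
have h_lin : linear h by move=> r u v; apply: g_inj; rewrite linearP !hK.
pose hL : {linear V -> U} := HB.pack h (GRing.isLinear.Build R V U _ h h_lin).
by exists hL; split=> // u; apply: g_inj; exact: hK.
Qed.

Section IntervalCoordinates.
Variable R : nzRingType.

(** A coordinate that is 0 on the zero module, so that later arguments treat points inside and
    outside an interval uniformly. *)
Definition interval_coef (b : bool) : interval_obj R b -> R :=
  match b with true => fun r => r | false => fun=> 0 end.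

Definition interval_one (b : bool) : interval_obj R b :=
  match b with true => 1 | false => 0 end.

Lemma interval_coef_linear b (r : R) (x y : interval_obj R b) :
  interval_coef (r *: x + y) = r * interval_coef x + interval_coef y.
Proof. by case: b x y => //= _ _; rewrite mulr0 addr0. Qed.

Lemma interval_coefK b (x : interval_obj R b) :
  x = interval_coef x *: interval_one b.
Proof. by case: b x => [x|x] /=; [rewrite [RHS]mulr1 | rewrite scaler0; exact: thinmx0]. Qed.

Lemma interval_coef_map b c (x : interval_obj R b) :
  interval_coef (interval_map R b c x) = if c then interval_coef x else 0.
Proof. by case: b x; case: c. Qed.

Lemma interval_coef_out b (x : interval_obj R b) : ~~ b -> interval_coef x = 0.
Proof. by case: b x. Qed.

Lemma interval_coef_one (b : bool) : b -> interval_coef (interval_one b) = 1.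
Proof. by case: b. Qed.

Lemma interval_one_out (b : bool) : ~~ b -> interval_one b = 0.
Proof. by case: b. Qed.

Lemma interval_map_one (b c : bool) : b ->
  interval_map R b c (interval_one b) = interval_one c.
Proof. by case: b => // _; case: c. Qed.

End IntervalCoordinates.

(** * Correspondence between bars and interval submodules *)

Section BarsAndIntervals.
Variables (R : idomainType) (d : Order.disp_t) (I : orderType d).
Variable f : persistence_module R I.
Hypothesis f_tf : forall x : I, saturated [set (0 : f x)].
Local Notation tr := (tr f).

Lemma bar_tr_cyclic (e : forall x, f x) (x y : I) (xy : (x <= y)%O) v :
  bar e -> v \in cyclic (e x) -> pm_map f xy v \in cyclic (e y).
Proof.
move=> e_bar /cyclicP[r ->]; apply/cyclicP; rewrite -trE trZ.
have [->|ex] := eqVneq (e x) 0; first by exists 0; rewrite linear0 scale0r scaler0.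
by exists r; rewrite (e_bar x y).
Qed.

Definition bar_submodule (e : forall x, f x) (e_bar : bar e) : persistence_submodule f :=
  PersistenceSubmodule (psub_at := fun x => cyclic (e x) : submodClosed (f x))
    (fun x y xy v => @bar_tr_cyclic e x y xy v e_bar).

Section BarInterval.
Variables (e : forall x, f x) (e_bar : bar e).

Lemma bar_support_convex (x y z : I) : e x <> 0 -> e y <> 0 -> (x <= z <= y)%O -> e z <> 0.
Proof.
move=> /eqP ex ey /andP[xz zy] ez; apply: ey.
by rewrite -(e_bar (le_trans xz zy) ex) -(tr_comp _ xz zy) (e_bar xz ex) ez linear0.
Qed.

Definition bar_interval : Defs.interval I :=
  @Defs.Interval d I [set x | e x <> 0] bar_support_convex.

Let inJ x : bool := x \in (bar_interval : set I).

Let inJE x : inJ x = (e x != 0).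
Proof. by apply/idP/idP => [|/eqP] ex; [apply/eqP; rewrite inE in ex | rewrite /inJ inE]. Qed.

Fact bar_vec_mem x (t : interval_obj R (inJ x)) :
  interval_coef t *: e x \in cyclic (e x).
Proof. by apply/cyclicP; exists (interval_coef t). Qed.

Let bar_vec x (t : interval_obj R (inJ x)) : submodule (cyclic (e x)) :=
  Sub (interval_coef t *: e x) (bar_vec_mem t).

Let bar_vec_linear x : linear (@bar_vec x).
Proof.
move=> r t u; apply: val_inj.
by rewrite /= interval_coef_linear scalerDl scalerA.
Qed.

Let bar_vecL x : {linear interval_obj R (inJ x) -> submodule (cyclic (e x))} :=
  HB.pack (@bar_vec x) (GRing.isLinear.Build R _ _ _ (@bar_vec x) (@bar_vec_linear x)).

(** On the support, torsion-freeness makes scaling [e x] an isomorphism from [R] onto the line of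
    [e x]; off the support both modules are zero. *)
Lemma bar_submodule_interval : is_interval_submodule (bar_submodule e_bar).
Proof.
exists bar_interval.
have inj x : injective (bar_vecL x).
  move=> t u /(congr1 val) /= tu; rewrite (interval_coefK t) (interval_coefK u).
  congr (_ *: _); have [ex|ex] := eqVneq (e x) 0.
    by rewrite !interval_coef_out // inJE ex eqxx.
  apply/eqP; rewrite -subr_eq0; apply/negPn/negP => tu0.
  by case/eqP: ex; apply: (f_tf tu0); rewrite /= scalerBl tu subrr.
have surj x (v : submodule (cyclic (e x))) : exists t, bar_vecL x t = v.
  have /cyclicP[r vr] := valP v; exists (r *: interval_one R (inJ x)).
  apply: val_inj; rewrite vr /=.
  have [->|ex] := eqVneq (e x) 0; first by rewrite !scaler0.
  rewrite -[_ *: interval_one _ _]addr0 interval_coef_linear.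
  have -> : interval_coef (0 : interval_obj R (inJ x)) = 0.
    by case: (inJ x).
  by rewrite addr0 interval_coef_one ?mulr1 // inJE.
pose h x := projT1 (cid (linear_inverse (@inj x) (surj x))).
have hP x : cancel (bar_vecL x) (h x) /\ cancel (h x) (bar_vecL x).
  exact: projT2 (cid (linear_inverse (@inj x) (surj x))).
have psi_nat x y (xy : (x <= y)%O) (t : interval_module R bar_interval x) :
    bar_vecL y (pm_map (interval_module R bar_interval) xy t) =
    pm_map (psub_module (bar_submodule e_bar)) xy (bar_vecL x t).
  apply: val_inj; rewrite /= interval_coef_map -/(inJ y) inJE -trE trZ.
  have [ex|ex] := eqVneq (e x) 0.
    rewrite ex linear0 scaler0 [interval_coef t]interval_coef_out -/(inJ x) ?inJE ?ex ?eqxx //.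
    by case: ifP => _; rewrite scale0r.
  rewrite (e_bar xy) //; case: eqVneq => [->|//]; by rewrite !scaler0.
have phi_nat x y (xy : (x <= y)%O) (v : psub_module (bar_submodule e_bar) x) :
    h y (pm_map (psub_module (bar_submodule e_bar)) xy v) =
    pm_map (interval_module R bar_interval) xy (h x v).
  by apply: (@inj y); rewrite (hP y).2 psi_nat (hP x).2.
pose P := psub_module (bar_submodule e_bar); pose Q := interval_module R bar_interval.
exists (PMMorphism (pm_comp := fun x => h x : {linear P x -> Q x}) phi_nat),
  (PMMorphism (pm_comp := fun x => bar_vecL x : {linear Q x -> P x}) psi_nat) => x.
by split; [exact: (hP x).2 | exact: (hP x).1].
Qed.

End BarInterval.

(** The bar is the image of the unit section of the interval module under the isomorphism. *)
Lemma interval_submodule_bar (N : persistence_submodule f) : is_interval_submodule N ->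
  exists e : forall x, f x, bar e /\ forall x v, v \in N x <-> exists r : R, v = r *: e x.
Proof.
move=> [J [phi [psi phiK]]].
pose e x : f x := val (psi x (interval_one R (x \in (J : set I)))).
exists e; split=> [x y xy|x v].
  move=> ex; have Jx : x \in (J : set I).
    by apply: contraNT ex => Jx; rewrite /e interval_one_out // linear0.
  rewrite (trE xy) -[LHS]/(val (pm_map (psub_module N) xy (psi x _))).
  by rewrite -(pm_natural psi) /=; congr (val (psi y _)); apply: interval_map_one.
split=> [Nv|[r ->]]; last by rewrite rpredZ //; exact: valP (psi x _).
pose u : submodule (N x) := Sub v Nv.
exists (interval_coef (phi x u)).
have -> : v = val (psi x (phi x u)) by rewrite (phiK x).1.
by rewrite {1}(interval_coefK (phi x u)) linearZ.
Qed.

End BarsAndIntervals.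

(** * The two implications *)

Section Decomposition.
Variable R : idomainType.
Hypothesis R_pid : principal_ideal_domain R.
Variables (d : Order.disp_t) (I : orderType d) (f : persistence_module R I).
Hypothesis f_fg : forall x : I, finitely_generated (f x).
Hypothesis f_tf : forall x : I, saturated [set (0 : f x)].

Lemma range_saturated_decomposition :
    (forall x y : I, saturated (range (tr f x y))) ->
  has_interval_decomposition f.
Proof.
move=> range_sat.
have [B [B_bar B_ind B_span]] := exists_bar_basis R_pid f_fg f_tf range_sat.
(* The index set consists of all functions; those outside [B] index the zero
   submodule, which is the interval module of the empty interval. *)
pose b (k : barT f) : forall x, f x := if `[< B k >] then k else fun=> 0.
have bE k : B k -> b k = k by rewrite /b => Bk; rewrite asboolT.
have b_bar k : bar (b k).
  by rewrite /b; case: asboolP => [/B_bar//|_] x y _; rewrite eqxx.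
exists (barT f), (fun k => bar_submodule (b_bar k)); split; last first.
  by move=> k; exact: bar_submodule_interval.
move=> x v; have [s [c [s_uniq sB vE]]] := bar_span_seq (B_span x v).
pose u (k : barT f) : f x := if k \in s then c k *: k x else 0.
have u0 k : k \notin s -> u k = 0 by rewrite /u => /negPf ->.
have uv : \sum_(k \in [set: barT f]) u k = v.
  rewrite (fsum_seq u0) vE undup_id //; apply: eq_big_seq => k ks.
  by rewrite /u ks.
exists u; split.
  split; first by apply/finite_supportE; exists s.
  - move=> k; apply/cyclicP; have [ks|ks] := boolP (k \in s).
      by exists (c k); rewrite /u ks bE //; exact: sB.
    by exists 0; rewrite u0 // scale0r.
  - by rewrite uv.
move=> w [/finite_supportE[s' w0] wb vw].
have [r wE] := choice (fun k => cyclicP _ _ (wb k)).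
have w_out k : ~ B k -> w k = 0.
  by move=> nBk; rewrite wE /b asboolF // scaler0.
(* Both families vanish outside [t], and the filter keeps only members of [B], to which independence
   applies. *)
pose t := [seq k <- s ++ s' | `[< B k >]].
have tP k : k \notin t -> u k = 0 /\ w k = 0.
  rewrite mem_filter mem_cat negb_and => /orP[/asboolPn nBk|].
    by split; [apply/u0/negP => /sB | exact: w_out].
  by rewrite negb_or => /andP[/u0 -> /w0 ->].
have uw : \sum_(k <- undup t) ((if k \in s then c k else 0) - r k) *: k x = 0.
  transitivity (\sum_(k <- undup t) (u k - w k)).
    apply: eq_big_seq => k; rewrite mem_undup mem_filter => /andP[/asboolP Bk _].
    rewrite scalerBl wE bE // /u; congr (_ - _).
    by case: ifP => // _; rewrite scale0r.
  rewrite sumrB -(fsum_seq (s := t)) => [|k /tP[]//].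
  rewrite -(fsum_seq (s := t)) => [|k /tP[]//].
  by rewrite -vw uv subrr.
apply/funext => k; have [kt|/tP[-> ->]//] := boolP (k \in t).
have Bk : B k by move: kt; rewrite mem_filter => /andP[/asboolP].
have tB : [set` undup t] `<=` B.
  by move=> l /=; rewrite mem_undup mem_filter => /andP[/asboolP].
have := B_ind x _ _ (undup_uniq t) tB uw k; rewrite mem_undup kt => /(_ isT)/eqP.
rewrite scalerBl subr_eq0 wE bE // /u => /eqP <-.
by case: ifP => // _; rewrite scale0r.
Qed.

(** The bars alive at [b] and zero at [a] give a basis of the cokernel: a bar alive at both points
    has its value at [b] in the image. *)
Lemma decomposition_coker_free (a b : I) (ab : (a <= b)%O) :
  has_interval_decomposition f -> free_module (cokernel (pm_map f ab)).
Proof.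
move=> [K [N [N_dec N_int]]].
have [e eP] := choice (fun k => interval_submodule_bar (N_int k)).
have e_bar k : bar (e k) := (eP k).1.
set g := pm_map f ab.
have ge k : e k a != 0 -> g (e k a) = e k b by move=> ek; rewrite -(e_bar k a b ab ek) (trE ab).
have N_uniq (x : I) (u w : K -> f x) (s t : seq K) :
    (forall k, u k \in N k x) -> (forall k, w k \in N k x) ->
    (forall k, k \notin s -> u k = 0) -> (forall k, k \notin t -> w k = 0) ->
    \sum_(k <- undup s) u k = \sum_(k <- undup t) w k -> u = w.
  move=> uN wN u0 w0 uw; have [z [_ z_uniq]] := N_dec x (\sum_(k <- undup s) u k).
  rewrite -(z_uniq u) ?(z_uniq w) //; split=> //.
  - by apply/finite_supportE; exists t.
  - by rewrite uw (fsum_seq w0).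
  - by apply/finite_supportE; exists s.
  - by rewrite (fsum_seq u0).
have N_coef (x : I) (v : f x) : exists (s : seq K) (u : K -> f x),
    [/\ forall k, u k \in N k x, forall k, k \notin s -> u k = 0 &
        v = \sum_(k <- undup s) u k].
  have [u [[/finite_supportE[s u0] uN vE] _]] := N_dec x v.
  by exists s, u; split=> //; rewrite -(fsum_seq u0).
pose L := {k : K | (e k b != 0) && (e k a == 0)}.
pose q (l : L) : cokernel g := coker_proj g (e (val l) b).
have eN k x : e k x \in N k x by apply/(eP k).2; exists 1; rewrite scale1r.
have q_indep (c : L -> R) (s : seq L) : (forall l, l \notin s -> c l = 0) ->
    \sum_(l <- undup s) c l *: q l = 0 -> forall l, c l = 0.
  move=> c0 sum0 l.
  have [w _ gw] : range g (\sum_(l <- undup s) c l *: e (val l) b).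
    apply/coker_proj_eq0; rewrite -[RHS]sum0 linear_sum.
    by apply: eq_bigr => l' _; rewrite linearZ.
  have [t [z [zN z0 wE]]] := N_coef a w.
  (* [A] and [C] decompose the same element of [f b] along the summands, so they coincide; at an
     index of [L] the entry of [A] is zero. *)
  pose A k := g (z k).
  pose C k := if insub k is Some l' then c l' *: e k b else 0 : f b.
  have AC : A = C.
    apply: (@N_uniq b _ _ t (map val s)).
    - move=> k; rewrite /A; have [r ->] := ((eP k).2 a _).1 (zN k).
      rewrite (_ : g _ = r *: g (e k a)); last exact: linearZ.
      apply: rpredZ; have [->|ek] := eqVneq (e k a) 0; last by rewrite ge ?eN.
      by rewrite linear0 rpred0.
    - by move=> k; rewrite /C; case: insub => [l'|]; [apply/rpredZ/eN|exact: rpred0].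
    - by move=> k /z0; rewrite /A => ->; rewrite linear0.
    - move=> k; rewrite /C; case: insubP => // l' _ <-.
      by rewrite (mem_map val_inj) => /c0 ->; rewrite scale0r.
    - rewrite -linear_sum -wE gw (undup_map_inj val_inj).
      by rewrite big_map; apply: eq_bigr => l' _; rewrite /C valK.
  have /andP[elb /eqP ela] := valP l.
  apply/eqP/negPn/negP => cl; case/eqP: elb; apply: (f_tf cl) => /=.
  have [r zr] := ((eP (val l)).2 a _).1 (zN (val l)).
  have := congr1 (fun F => F (val l)) AC.
  by rewrite /A /C valK zr ela scaler0 linear0.
exists L, q => y; have [v ->] := coker_proj_surj y.
have [s [u [uN u0 vE]]] := N_coef b v.
have [r rE] := choice (fun k => ((eP k).2 b (u k)).1 (uN k)).
pose c (l : L) := if val l \in s then r (val l) else 0.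
pose s' : seq L := pmap insub (undup s).
have s'_uniq : uniq s' by rewrite pmap_sub_uniq // undup_uniq.
have c0 l : l \notin s' -> c l = 0.
  by rewrite mem_pmap_sub mem_undup /c => /negPf ->.
have sum_c : coker_proj g v = \sum_(l <- s') c l *: q l.
  rewrite vE linear_sum big_pmap; apply: eq_big_seq => k; rewrite mem_undup => ks.
  case: insubP => [l _ lk|] /=.
    by rewrite /c /q lk ks rE linearZ.
  rewrite negb_and negbK rE linearZ /= => /orP[/eqP ->|/ge <-].
    by rewrite linear0 scaler0.
  have -> : coker_proj g (g (e k a)) = 0 by apply/coker_proj_eq0; exists (e k a).
  by rewrite scaler0.
have fsum_c (c' : L -> R) (t : seq L) : (forall l, l \notin t -> c' l = 0) ->
    \sum_(l \in [set: L]) c' l *: q l = \sum_(l <- undup t) c' l *: q l.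
  by move=> c'0; apply: fsum_seq => l /c'0 ->; rewrite scale0r.
exists c; split.
  split; first by apply/(@finite_supportE _ R^o); exists s'.
  by rewrite (fsum_c _ s') // undup_id.
move=> c' [/(@finite_supportE _ R^o)[t c'0] c'E].
have c0t l : l \notin s' ++ t -> c l = 0 /\ c' l = 0.
  by rewrite mem_cat negb_or => /andP[/c0 -> /c'0 ->].
apply/funext => l; apply/eqP; rewrite -subr_eq0; apply/eqP.
apply: (q_indep (fun l => c l - c' l) (s' ++ t)).
  by move=> l' /c0t[-> ->]; rewrite subrr.
under eq_bigr do rewrite scalerBl.
rewrite sumrB -!fsum_c => [|l' /c0t[]//|l' /c0t[]//].
by rewrite -c'E (fsum_c _ s') // undup_id // sum_c subrr.
Qed.

End Decomposition.

Theorem theorem1p1 (R : idomainType) (R_pid : principal_ideal_domain R)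
    (d : Order.disp_t) (I : orderType d) (f : persistence_module R I)
    (f_fg : forall i : I, finitely_generated (f i))
    (f_free : forall i : I, free_module (f i)) :
  has_interval_decomposition f <->
  (forall (a b : I) (ab : (a <= b)%O), free_module (cokernel (pm_map f ab))).
Proof.
have f_tf x : saturated [set (0 : f x)] by exact: free_torsionfree.
split=> [f_dec a b ab|coker_free]; first exact: decomposition_coker_free.
apply: range_saturated_decomposition => // x y; rewrite /tr.
case: pselect => [xy|_]; first exact: coker_free_range_saturated.
(* Here [tr] is the zero map by default, and its image is saturated because [f y] is
   torsion-free. *)
move=> r v r0 [w _ /= wv]; exists 0; rewrite ?linear0 //.
by apply/esym/(f_tf y r v r0); rewrite /= -wv.
Qed.
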